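(* Let $\mathcal{F}$ be a commutative perfect semi-field of characteristic $1$ (satisfying the standing assumptions in the context) which is complete for an F-norm $\|\cdot\|$. 1. Let $\sim_1$ be a non-trivial congruence on $\mathcal{F}$. Then there exists a maximal congruence $\sim_2$ on $\mathcal{F}$ such that $\sim_1\,\le\,\sim_2$. 2. Each maximal congruence $\sim$ on $\mathcal{F}$ is closed, i.e. it defines a closed subset of $\mathcal{F}\times\mathcal{F}$.
   Context: A commutative perfect semi-field of characteristic $1$ is a triple $(\mathcal{F},\oplus,+)$ where: $\oplus$ is a commutative associative law with $X\oplus X=X$ for all $X$; $(\mathcal{F},+)$ is an abelian group with identity $0$ and $X+(Y\oplus Z)=(X+Y)\oplus(X+Z)$ for all $X,Y,Z$; for every integer $n\ge 1$ the map $X\mapsto nX$ is surjective (it is then bijective, and $(\mathcal F,+)$ is naturally a $\mathbb{Q}$-vector space). Partial order: $X\le Y$ iff $X\oplus Y=Y$. Standing assumptions: $\mathcal{F}\neq\{0\}$; there is a fixed $E\in\mathcal{F}$ such that for every $X\in\mathcal{F}$ there is $t\in\mathbb{Q}^+$ (non-negative rationals) with $-tE\le X\le tE$; $r(X)\in\mathbb{R}^+$ denotes the infimum of all such $t$; and $r(X)=0$ if and only if $X=0$. An F-norm on $\mathcal{F}$ is a map $\|\cdot\|:\mathcal{F}\to\mathbb{R}^+$ such that for all $t\in\mathbb{Q}$ and $X,Y,X',Y'\in\mathcal{F}$: $\|tX\|=|t|\,\|X\|$, $\|X+Y\|\le\|X\|+\|Y\|$, $r(X)\le\|X\|$, and $\|X\oplus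 Y-X'\oplus Y'\|\le\max(\|X-X'\|,\|Y-Y'\|)$. $\mathcal{F}$ is complete for $\|\cdot\|$ if it is complete for the distance $(X,Y)\mapsto\|X-Y\|$; topological notions refer to this distance. A congruence on $\mathcal{F}$ is an equivalence relation $\sim$ such that $X\sim Y$ implies $-X\sim -Y$, $X+Z\sim Y+Z$ and $X\oplus Z\sim Y\oplus Z$ for all $Z$. The trivial congruence is the one for which $X\sim Y$ for all $X,Y$. Write $\sim_1\le\sim_2$ if $X\sim_1Y$ implies $X\sim_2Y$. A congruence $\sim$ is maximal if it is not trivial and $\sim\,\le\,\sim'$ (with $\sim'$ a congruence) implies that $\sim'=\sim$ or that $\sim'$ is trivial. *)

(* Defs.v *)
From HB Require Import structures.
From mathcomp Require Import all_boot all_order all_algebra.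
From mathcomp Require Import all_classical all_reals all_analysis.

Set Implicit Arguments.
Unset Strict Implicit.
Unset Printing Implicit Defensive.

Import Order.TTheory GRing.Theory Num.Theory.
Import numFieldNormedType.Exports.

Local Open Scope classical_set_scope.
Local Open Scope ring_scope.

(* Commutative perfect semi-fields of characteristic 1.  The law called + in
   the max-plus notation is the + of the underlying zmodType; [oplus] is the
   idempotent law. *)
HB.mixin Record Zmodule_isPerfectSemifield F of GRing.Zmodule F := {
  oplus : F -> F -> F;
  oplusC : commutative oplus;
  oplusA : associative oplus;
  oplusxx : idempotent_op oplus;
  addr_oplusr : right_distributive +%R oplus;
  mulrn_surj : forall n : nat, (0 < n)%N ->
    forall Y : F, exists X : F, X *+ n = Y
}.

#[short(type="perfectSemifieldType")]
HB.structure Definition PerfectSemifield :=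
  { F of GRing.Zmodule F & Zmodule_isPerfectSemifield F }.

Notation "X (+) Y" := (oplus X Y) : ring_scope.

Section RationalScaling.
Variable F : perfectSemifieldType.
Implicit Types (X Y : F) (n : nat) (t : rat).

(* With S = 0 (+) X (+) ... (+) nX, the relation (n+1)X = 0 gives X + S = S. *)
Lemma mulrn_torsion_free X n : (0 < n)%N -> X *+ n = 0 -> X = 0.
Proof.
case: n => // n _ Xn0.
pose s := fix s k := if k is k'.+1 then s k' (+) (X *+ k) else 0 : F.
have sS k : s k.+1 = s k (+) (X *+ k.+1) by [].
have sD k : (X + s k) (+) 0 = s k.+1.
  elim: k => [|k IHk]; first by rewrite /= addr0 mulr1n oplusC.
  rewrite sS addr_oplusr -mulrS -oplusA [X *+ _ (+) 0]oplusC oplusA IHk.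
  by rewrite -sS.
have sI k : s k (+) (X *+ k) = s k.
  by case: k => [|k]; rewrite ?mulr0n ?oplusxx// sS -oplusA oplusxx.
have sn : s n.+1 = s n.
  rewrite sS Xn0; have s0 k : s k (+) 0 = s k; last exact: s0.
  elim: k => [|k IHk]; first exact: oplusxx.
  by rewrite sS -oplusA [_ (+) 0]oplusC oplusA IHk.
have : X + s n = s n by rewrite -{2}sn -sD -[in RHS]Xn0 mulrS -addr_oplusr sI.
by move=> /eqP; rewrite -subr_eq0 addrK => /eqP.
Qed.

Lemma mulrz_inj (m : int) X Y : m != 0 -> X *~ m = Y *~ m -> X = Y.
Proof.
move=> m0 /eqP; rewrite -subr_eq0 -mulrzBl => /eqP XYm.
apply/eqP; rewrite -subr_eq0; apply/eqP.
apply: (@mulrn_torsion_free _ `|m|%N); first by rewrite absz_gt0.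
case: m m0 XYm => [k|k] _ //.
by rewrite NegzE mulrNz abszN => /eqP; rewrite oppr_eq0 => /eqP.
Qed.

Lemma ratscale_ex t X : exists Y, Y *~ denq t == X *~ numq t.
Proof.
have d0 : (0 < `|denq t|)%N by rewrite absz_gt0 denq_eq0.
have [Y YE] := mulrn_surj _ d0 (X *~ numq t).
by exists Y; rewrite -YE pmulrn absz_denq.
Qed.

Definition ratscale t X : F := xchoose (ratscale_ex t X).

Lemma ratscaleP t X : ratscale t X *~ denq t = X *~ numq t.
Proof. by apply/eqP; exact: (xchooseP (ratscale_ex t X)). Qed.

Lemma ratscale_frac t (p q : int) X :
  q != 0 -> t = p%:~R / q%:~R -> ratscale t X *~ q = X *~ p.
Proof.
move=> q0 tE; apply: (@mulrz_inj (denq t)); first exact: denq_neq0.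
rewrite mulrzAC ratscaleP -!mulrzA; congr (_ *~ _).
apply: (@intr_inj rat); rewrite !rmorphM /=.
have q0' : q%:~R != 0 :> rat by rewrite intr_eq0.
have pE : p%:~R = t * q%:~R :> rat by rewrite tE divfK.
by rewrite pE numqE mulrAC.
Qed.

Let ratscale_eq t (p q : int) X Y :
  q != 0 -> t = p%:~R / q%:~R -> Y *~ q = X *~ p -> ratscale t X = Y.
Proof.
by move=> q0 tE YE; apply: (mulrz_inj q0); rewrite YE (ratscale_frac _ q0 tE).
Qed.

Let ratscaleA s t X : ratscale s (ratscale t X) = ratscale (s * t) X.
Proof.
apply/esym/(@ratscale_eq _ (numq s * numq t) (denq s * denq t)).
- by rewrite mulf_neq0 ?denq_neq0.
- by rewrite -{1}(divq_num_den s) -{1}(divq_num_den t) !rmorphM/= mulf_div.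
by rewrite mulrzA ratscaleP mulrzAC ratscaleP -mulrzA mulrC.
Qed.

Let ratscale1 X : ratscale 1 X = X.
Proof. by apply: (@ratscale_eq _ 1 1) => //; rewrite divr1. Qed.

Let ratscaleDr t : {morph ratscale t : X Y / X + Y}.
Proof.
move=> X Y; apply: (@ratscale_eq _ (numq t) (denq t)).
- exact: denq_neq0.
- by rewrite divq_num_den.
by rewrite !mulrzDl !ratscaleP.
Qed.

Let ratscaleDl X : {morph ratscale^~ X : s t / s + t}.
Proof.
move=> s t.
apply: (@ratscale_eq _ (numq s * denq t + numq t * denq s) (denq s * denq t)).
- by rewrite mulf_neq0 ?denq_neq0.
- rewrite -{1}(divq_num_den s) -{1}(divq_num_den t) addf_div ?intr_eq0//.
  by rewrite rmorphD !rmorphM.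
rewrite mulrzDl mulrzDr !mulrzA ratscaleP; congr (_ + _).
by rewrite mulrzAC ratscaleP mulrzAC.
Qed.

HB.instance Definition _ := GRing.Zmodule_isLmodule.Build rat F
  ratscaleA ratscale1 ratscaleDr ratscaleDl.

End RationalScaling.

Section Semifield.
Context (R : realType) (F : perfectSemifieldType).
Implicit Types (E X Y : F) (t : rat).

Definition oplus_le X Y : Prop := X (+) Y = Y.

Definition bounding_scalars E X : set rat :=
  [set t | [/\ 0 <= t, oplus_le (- (t *: E)) X & oplus_le X (t *: E)]].

Definition order_unit E : Prop := forall X, bounding_scalars E X !=set0.

Definition unit_radius E X : R := inf [set ratr t | t in bounding_scalars E X].

Record fnorm E := FNorm {
  fnorm_fun :> F -> R;
  fnorm_ge0 : forall X, 0 <= fnorm_fun X;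
  fnormZ : forall t X, fnorm_fun (t *: X) = ratr `|t| * fnorm_fun X;
  ler_fnormD : forall X Y, fnorm_fun (X + Y) <= fnorm_fun X + fnorm_fun Y;
  unit_radius_le_fnorm : forall X, unit_radius E X <= fnorm_fun X;
  fnorm_oplus : forall X Y X' Y',
    fnorm_fun ((X (+) Y) - (X' (+) Y')) <=
      Num.max (fnorm_fun (X - X')) (fnorm_fun (Y - Y'))
}.

Record semifield_congruence (S : F -> F -> Prop) : Prop := Congruence {
  congr_refl : forall X, S X X;
  congr_sym : forall X Y, S X Y -> S Y X;
  congr_trans : forall X Y Z, S X Y -> S Y Z -> S X Z;
  congr_opp : forall X Y, S X Y -> S (- X) (- Y);
  congr_add : forall X Y Z, S X Y -> S (X + Z) (Y + Z);
  congr_oplus : forall X Y Z, S X Y -> S (X (+) Z) (Y (+) Z)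
}.

Definition trivial_relation (S : F -> F -> Prop) : Prop := forall X Y, S X Y.

Definition congruence_le (S1 S2 : F -> F -> Prop) : Prop :=
  forall X Y, S1 X Y -> S2 X Y.

Definition maximal_congruence (S : F -> F -> Prop) : Prop :=
  [/\ semifield_congruence S, ~ trivial_relation S &
      forall S', semifield_congruence S' -> congruence_le S S' ->
        S' = S \/ trivial_relation S'].

End Semifield.

(* A copy of F carrying the topology of the distance |X - Y|_N. *)
Definition fnorm_space (R : realType) (F : perfectSemifieldType) (E : F)
  (N : fnorm R E) : Type := F.

Section FNormSpace.
Context (R : realType) (F : perfectSemifieldType) (E : F) (N : fnorm R E).
Local Notation T := (fnorm_space N).

HB.instance Definition _ := Choice.copy T F.
HB.instance Definition _ := isPointed.Build T (0 : F).

Definition fnorm_ball (X : T) (e : R) : set T :=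
  [set Y : T | N ((X : F) - (Y : F)) < e].

Let ball_center (X : T) (e : R) : 0 < e -> fnorm_ball X e X.
Proof.
move=> e0; rewrite /fnorm_ball /= subrr -[X in N X](scale0r (0 : F)).
by rewrite fnormZ normr0 rmorph0 mul0r.
Qed.

Let ball_sym (X Y : T) (e : R) : fnorm_ball X e Y -> fnorm_ball Y e X.
Proof.
rewrite /fnorm_ball /= -opprB -scaleN1r fnormZ normrN1 rmorph1 mul1r.
by [].
Qed.

Let ball_triangle (X Y Z : T) (e1 e2 : R) :
  fnorm_ball X e1 Y -> fnorm_ball Y e2 Z -> fnorm_ball X (e1 + e2) Z.
Proof.
rewrite /fnorm_ball /= => XY YZ.
rewrite -[X in N (X - _)](subrK (Y : F)) -addrA.
by rewrite (le_lt_trans (ler_fnormD _ _ _))// ltrD.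
Qed.

Let ent : set_system (T * T) := entourage_ fnorm_ball.

HB.instance Definition _ := hasNbhs.Build T (nbhs_ ent).
HB.instance Definition _ := @Nbhs_isPseudoMetric.Build R T
  ent erefl fnorm_ball ball_center ball_sym ball_triangle erefl.

(* The axiom of completeType, as a proposition. *)
Definition fnorm_complete : Prop :=
  forall G : set_system T, ProperFilter G -> cauchy G -> cvg G.

End FNormSpace.

(* Main.v *)
Require Import Defs.
From HB Require Import structures.
From mathcomp Require Import all_boot all_order all_algebra.
From mathcomp Require Import all_classical all_reals all_analysis.

Set Implicit Arguments.
Unset Strict Implicit.
Unset Printing Implicit Defensive.

Import Order.TTheory GRing.Theory Num.Theory.
Import numFieldNormedType.Exports.

Local Open Scope classical_set_scope.
Local Open Scope ring_scope.

(** A congruence is trivial exactly when it identifies the order unit [E] with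
    [0], because the class of [0] is convex.  Zorn's lemma therefore applies to
    the congruences that separate [E] from [0].  The closure of a congruence is
    again a congruence, since the operations are Lipschitz for an F-norm, and it
    still separates [E] from [0]: if [W ~ 0] is at distance less than [1/2] from
    [E], then [E <= 2W], and hence [E ~ 0].  So a maximal congruence equals its
    closure. *)

(** * The order induced by [oplus], and its compatibility with rational scaling *)

Section Order.
Variable F : perfectSemifieldType.
Implicit Types X Y Z : F.

Lemma oplus_le_trans X Y Z : oplus_le X Y -> oplus_le Y Z -> oplus_le X Z.
Proof. by rewrite /oplus_le => XY YZ; rewrite -YZ oplusA XY. Qed.

Lemma oplus_le_antisym X Y : oplus_le X Y -> oplus_le Y X -> X = Y.
Proof. by rewrite /oplus_le => XY; rewrite oplusC XY. Qed.

Lemma oplus_leD2l Z X Y : oplus_le (Z + X) (Z + Y) <-> oplus_le X Y.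
Proof.
by rewrite /oplus_le -addr_oplusr; split=> [/addrI|->].
Qed.

Lemma oplus_leB0 X Y : oplus_le 0 (Y - X) <-> oplus_le X Y.
Proof. by rewrite -(oplus_leD2l X) addr0 subrKC. Qed.

Lemma oplus_leN X Y : oplus_le X Y -> oplus_le (- Y) (- X).
Proof. by move=> XY; apply/oplus_leB0; rewrite opprK addrC oplus_leB0. Qed.

Lemma oplus_addr_ge0 X Y : oplus_le 0 X -> oplus_le 0 Y -> oplus_le 0 (X + Y).
Proof.
move=> X0 Y0; apply: (oplus_le_trans X0).
by rewrite -[X in oplus_le X _]addr0 oplus_leD2l.
Qed.

Lemma oplus_mulrn_ge0 X n : oplus_le 0 X -> oplus_le 0 (X *+ n).
Proof.
move=> X0; elim: n => [|n IHn]; first exact: oplusxx.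
by rewrite mulrS; exact: oplus_addr_ge0.
Qed.

(* With [S = 0 (+) X (+) ... (+) nX], the hypothesis gives
   [X + S = S (+) (n+1)X >= S]. *)
Lemma oplus_mulrn_ge0_inv X n : oplus_le 0 (X *+ n.+1) -> oplus_le 0 X.
Proof.
pose s := fix s k := if k is k'.+1 then s k' (+) (X *+ k) else 0 : F.
have sS k : s k.+1 = s k (+) (X *+ k.+1) by [].
have sD k : (X + s k) (+) 0 = s k.+1.
  elim: k => [|k IHk]; first by rewrite /= addr0 mulr1n oplusC.
  by rewrite sS addr_oplusr -mulrS -oplusA [X *+ _ (+) 0]oplusC oplusA IHk.
have sI k : s k (+) (X *+ k) = s k.
  by case: k => [|k]; rewrite ?mulr0n ?oplusxx// sS -oplusA oplusxx.
rewrite /oplus_le => Xn.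
have sE : X + s n = s n.+1.
  rewrite -sD -{1}(sI n) addr_oplusr -mulrS -Xn oplusA sD.
  by rewrite sS -oplusA oplusxx.
apply/(oplus_leD2l (s n)).
by rewrite addr0 addrC sE /oplus_le sS oplusA oplusxx.
Qed.

(** Clearing the denominator of [t] leaves a natural multiple of [X], and non-negativity descends
    from a positive multiple to the element itself. *)
Lemma oplus_scale_ge0 (t : rat) X :
  0 <= t -> oplus_le 0 X -> oplus_le 0 (t *: X).
Proof.
move=> t0 X0.
have d0 : (0 < `|denq t|)%N by rewrite absz_gt0 denq_eq0.
apply: (@oplus_mulrn_ge0_inv _ (`|denq t|.-1)); rewrite prednK//.
suff -> : (t *: X) *+ `|denq t| = X *+ `|numq t| by exact: oplus_mulrn_ge0.
rewrite -!scaler_nat scalerA; congr (_ *: _).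
by rewrite mulrC !natr_absz normr_denq ger0_norm ?numq_ge0// numqE.
Qed.

Lemma oplus_scale_le (s t : rat) X :
  s <= t -> oplus_le 0 X -> oplus_le (s *: X) (t *: X).
Proof.
move=> st X0; apply/oplus_leB0; rewrite -scalerBl.
by apply: oplus_scale_ge0 => //; rewrite subr_ge0.
Qed.

(** A nonzero [X] with [-tE <= X <= tE] forces [t > 0]; the two bounds together give [0 <= 2tE],
    which is then divided by [2t]. *)
Lemma order_unit_ge0 (E : F) :
  (exists X : F, X <> 0) -> order_unit E -> oplus_le 0 E.
Proof.
move=> [X X0] /(_ X)[t [t0 tX Xt]].
have {X0}t0 : 0 < t.
  rewrite lt_neqAle t0 andbT; apply/eqP => tE; apply: X0.
  by move: tX Xt; rewrite -tE scale0r oppr0 => X_ge0 /oplus_le_antisym; exact.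
have : oplus_le 0 (t *: E - - (t *: E)).
  by apply/oplus_leB0; exact: oplus_le_trans tX Xt.
have t20 : t + t != 0 by rewrite lt0r_neq0// addr_gt0.
rewrite opprK -scalerDl => /(@oplus_scale_ge0 (t + t)^-1).
by rewrite scalerA mulVf// scale1r; apply; rewrite invr_ge0 addr_ge0// ltW.
Qed.

End Order.

(** * Convexity of the class of [0] *)

Section Congruence.
Variable F : perfectSemifieldType.
Variable S : F -> F -> Prop.
Hypothesis S_congr : semifield_congruence S.
Implicit Types X Y A B : F.

Lemma congr_subr0 X Y : S (X - Y) 0 -> S X Y.
Proof. by move=> /(congr_add S_congr Y); rewrite subrK add0r. Qed.

Lemma congr_mulrn0 X n : S X 0 -> S (X *+ n) 0.
Proof.
move=> X0; elim: n => [|n IHn]; first exact: congr_refl.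
rewrite mulrS; have := congr_add S_congr (X *+ n) X0; rewrite add0r => XD.
exact: congr_trans XD IHn.
Qed.

(** Adding [X] with [oplus] to [A ~ 0 ~ B] gives the chain
    [X = A (+) X ~ 0 (+) X ~ B (+) X = B ~ 0]. *)
Lemma congr_convex A B X :
  S A 0 -> S B 0 -> oplus_le A X -> oplus_le X B -> S X 0.
Proof.
rewrite /oplus_le => A0 B0 AX XB.
have X0 : S X (0 (+) X) by rewrite -{1}AX; exact: congr_oplus.
have XB0 : S (0 (+) X) B.
  by have := congr_oplus S_congr X (congr_sym S_congr B0);
    rewrite [B (+) X]oplusC XB.
exact: congr_trans X0 (congr_trans S_congr XB0 B0).
Qed.

(** Once its bound [t] is rounded up to a natural number, every difference [X - Y] lies between two
    opposite multiples of [E], both congruent to [0]. *)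
Lemma congr_order_unit_trivial (E : F) :
  order_unit E -> oplus_le 0 E -> S E 0 -> trivial_relation S.
Proof.
move=> E_unit E0 SE X Y; apply: congr_subr0.
have [t [t0 tXY XYt]] := E_unit (X - Y).
have tn : t <= (Num.bound t)%:R by rewrite ltW// archi_boundP.
have tE : oplus_le (t *: E) (E *+ Num.bound t).
  by rewrite -scaler_nat; exact: oplus_scale_le.
have SnE : S (E *+ Num.bound t) 0 by exact: congr_mulrn0.
apply: (@congr_convex (- (E *+ Num.bound t)) (E *+ Num.bound t)) => //.
- by have := congr_opp S_congr SnE; rewrite oppr0.
- exact: oplus_le_trans (oplus_leN tE) tXY.
- exact: oplus_le_trans XYt tE.
Qed.

End Congruence.

(** * Existence of maximal congruences *)

Lemma maximal_congruence_exists (F : perfectSemifieldType) (E : F)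
    (S1 : F -> F -> Prop) :
  order_unit E -> oplus_le 0 E ->
  semifield_congruence S1 -> ~ trivial_relation S1 ->
  exists S2 : F -> F -> Prop, maximal_congruence S2 /\ congruence_le S1 S2.
Proof.
move=> E_unit E_ge0 S1C S1nt.
have nt S : semifield_congruence S -> ~ trivial_relation S -> ~ S E 0.
  by move=> SC Snt SE; apply: Snt; exact: congr_order_unit_trivial SE.
(* Adjoining [S1] makes the union of the empty chain admissible. *)
pose rel (A : set (F * F)) X Y := S1 X Y \/ A (X, Y).
(* Non-triviality is tested on the single pair [(E, 0)], so that it passes to unions of chains. *)
pose P A := semifield_congruence (rel A) /\ ~ rel A E 0.
have [C CP Ctot|A [[AC AE] Amax]] := @Zorn_bigcup (F * F)%type P.
  have relU X Y : rel (\bigcup_(A in C) A) X Y ->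
      S1 X Y \/ exists2 A, C A & rel A X Y.
    by case=> [|[A CA AXY]]; [left|right; exists A => //; right].
  have relC A X Y : C A -> rel A X Y -> rel (\bigcup_(A in C) A) X Y.
    by move=> CA [|AXY]; [left|right; exists A].
  split; last first.
    by case/relU => [|[A CA]]; [exact: nt|exact: (CP _ CA).2].
  split.
  - by move=> X; left; exact: congr_refl.
  - move=> X Y /relU[S1XY|[A CA AXY]]; first by left; exact: congr_sym.
    by apply: (relC A) => //; exact: (congr_sym (CP _ CA).1).
  - move=> X Y Z /relU[XY|[A CA XY]] /relU[YZ|[B CB YZ]].
    + by left; exact: congr_trans XY YZ.
    + by apply: (relC B) => //; apply: (congr_trans (CP _ CB).1 _ YZ); left.
    + by apply: (relC A) => //; apply: (congr_trans (CP _ CA).1 XY); left.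
    (* The chain is total, so both pairs lie in the larger relation, where transitivity applies. *)
    + have [AB|BA] := Ctot _ _ CA CB.
        apply: (relC B) => //; apply: (congr_trans (CP _ CB).1 _ YZ).
        by case: XY => [|/AB]; [left|right].
      apply: (relC A) => //; apply: (congr_trans (CP _ CA).1 XY).
      by case: YZ => [|/BA]; [left|right].
  - move=> X Y /relU[S1XY|[A CA AXY]]; first by left; exact: congr_opp.
    by apply: (relC A) => //; exact: (congr_opp (CP _ CA).1).
  - move=> X Y Z /relU[S1XY|[A CA AXY]]; first by left; exact: congr_add.
    by apply: (relC A) => //; exact: (congr_add (CP _ CA).1).
  - move=> X Y Z /relU[S1XY|[A CA AXY]]; first by left; exact: congr_oplus.
    by apply: (relC A) => //; exact: (congr_oplus (CP _ CA).1).
exists (rel A); split; last by move=> X Y; left.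
split=> [//|/(_ E 0)//|S' S'C AS'].
have [S't|S'nt] := pselect (trivial_relation S'); [by right|left].
(* If [S'] had a pair outside [A], then [B] would be an admissible set properly containing [A]. *)
pose B := [set XY : F * F | S' XY.1 XY.2].
have relB : rel B = S'.
  apply/funext => X; apply/funext => Y; apply/propext; split; last by right.
  by case=> // S1XY; apply: AS'; left.
have AB : A `<=` B by move=> [X Y] AXY; apply: AS'; right.
apply/funext => X; apply/funext => Y; apply/propext; split; last exact: AS'.
move=> S'XY; right; apply: contrapT => nAXY.
apply: (Amax B); last by rewrite /P relB; split=> //; exact: nt.
by split=> // /(_ (X, Y) S'XY).
Qed.

(** * The closure of a congruence *)

Section Closure.
Context (R : realType) (F : perfectSemifieldType) (E : F) (N : fnorm R E).
Implicit Types (X Y Z W : F) (S : F -> F -> Prop).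

Lemma fnorm0 : N 0 = 0.
Proof. by rewrite -[X in N X](scale0r (0 : F)) fnormZ normr0 rmorph0 mul0r. Qed.

Lemma fnormN X : N (- X) = N X.
Proof. by rewrite -scaleN1r fnormZ normrN1 rmorph1 mul1r. Qed.

(* Translating pairs by congruent elements, approximation in the first
   coordinate alone gives the closure of [S] in [F * F]. *)
Definition congruence_closure S X Y : Prop :=
  forall e : R, 0 < e -> exists2 W, S W Y & N (X - W) < e.

Lemma congruence_le_closure S : congruence_le S (congruence_closure S).
Proof. by move=> X Y SXY e e0; exists X => //; rewrite subrr fnorm0. Qed.

Lemma congruence_closureP S : semifield_congruence S ->
  semifield_congruence (congruence_closure S).
Proof.
move=> SC; split.
- by move=> X; apply: congruence_le_closure; exact: congr_refl.
(* Translating [Y ~ W] by [X - W] gives an element congruent to [X], at distance [N (X - W)] from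
   [Y]. *)
- move=> X Y XY e /XY[W WY XW]; exists (Y + (X - W)); last first.
    by rewrite opprD addrA subrr sub0r fnormN.
  by have := congr_add SC (X - W) (congr_sym SC WY); rewrite subrKC.
- move=> X Y Z XY YZ e e0.
  have [W WY XW] := XY _ (divr_gt0 e0 (ltr0n R 2)).
  have [V VZ YV] := YZ _ (divr_gt0 e0 (ltr0n R 2)).
  (* This is congruent to [Y + (V - Y) = V ~ Z], and its difference from [X] is the sum of the
     errors [X - W] and [Y - V]. *)
  exists (W + (V - Y)).
    have := congr_add SC (V - Y) WY; rewrite subrKC.
    by move=> /(congr_trans SC); apply.
  rewrite opprD opprB addrA (le_lt_trans (ler_fnormD _ _ _))//.
  by rewrite [ltRHS]splitr ltrD.
- move=> X Y XY e /XY[W WY XW]; exists (- W); first exact: congr_opp.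
  by rewrite -fnormN opprD !opprK.
- move=> X Y Z XY e /XY[W WY XW]; exists (W + Z); first exact: congr_add.
  by rewrite opprD addrACA subrr addr0.
- move=> X Y Z XY e e0; have [W WY XW] := XY _ e0.
  exists (W (+) Z); first exact: congr_oplus.
  by rewrite (le_lt_trans (fnorm_oplus _ _ _ _ _))// subrr fnorm0 gt_max XW.
Qed.

Lemma congruence_closure_nontrivial S :
  order_unit E -> oplus_le 0 E -> semifield_congruence S ->
  ~ trivial_relation S -> ~ trivial_relation (congruence_closure S).
Proof.
move=> E_unit E0 SC Snt /(_ E 0 2^-1)[|W W0 EW]; first by rewrite invr_gt0.
apply/Snt/(congr_order_unit_trivial SC E_unit E0).
have := le_lt_trans (unit_radius_le_fnorm _ _) EW.
(* The radius of [E - W] is below [1/2], so some admissible scalar [t] is too; the side goal is that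
   admissible scalars exist. *)
move=> /inf_lt[|_ [t [t0 _ EWt] <-] t2].
  by have [t tE] := E_unit (E - W); exists (ratr t), t.
have {}t2 : t <= 2^-1 by rewrite -(ler_rat R) fmorphV rmorph_nat ltW.
have EW2 : oplus_le (E - W) (2^-1 *: E).
  exact: oplus_le_trans EWt (oplus_scale_le t2 E0).
(* Doubling [E - W <= E/2] gives [2E - 2W <= E]. *)
have EleW2 : oplus_le E (W *+ 2).
  apply/oplus_leB0; move/oplus_leB0: EW2 => /(@oplus_mulrn_ge0 _ _ 2).
  suff -> : (2^-1 *: E - (E - W)) *+ 2 = W *+ 2 - E by [].
  rewrite mulrnBl scalerMnl -mulr_natl mulfV// scale1r mulrnBl opprB addrCA.
  by rewrite mulr2n opprD subrKC.
apply: (congr_convex SC _ _ E0 EleW2); first exact: congr_refl.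
exact: congr_mulrn0.
Qed.

Lemma congruence_closure_closed S : semifield_congruence S ->
  congruence_closure S = S ->
  closed [set XY : fnorm_space N * fnorm_space N | S XY.1 XY.2].
Proof.
move=> SC SE [X Y] clXY /=; rewrite -SE => e e0.
have e20 : 0 < e / 2 by rewrite divr_gt0.
have nX (Z : fnorm_space N) : nbhs Z (fnorm_ball Z (e / 2)).
  exact: (@nbhsx_ballx R (fnorm_space N)).
have [|[X' Y'] [/= SXY' [/= XX' YY']]] :=
    clXY (fnorm_ball X (e / 2) `*` fnorm_ball Y (e / 2)).
  by exists (fnorm_ball X (e / 2), fnorm_ball Y (e / 2)).
(* Translating [X' ~ Y'] by [Y - Y'] makes the second coordinate exactly [Y] and moves its error
   into the first. *)
exists ((X' : F) + ((Y : F) - (Y' : F))).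
  have := congr_add SC ((Y : F) - (Y' : F)) SXY'.
  by rewrite subrKC.
rewrite opprD addrA (le_lt_trans (ler_fnormD _ _ _))// fnormN.
by rewrite [ltRHS]splitr ltrD.
Qed.

End Closure.

Theorem theorem2 (R : realType) (F : perfectSemifieldType) (E : F)
    (F_neq0 : exists X : F, X <> 0)
    (E_unit : order_unit E)
    (radius_eq0 : forall X : F, unit_radius R E X = 0 <-> X = 0)
    (N : fnorm R E) (N_complete : fnorm_complete N) :
  (forall S1 : F -> F -> Prop, semifield_congruence S1 -> ~ trivial_relation S1 ->
     exists S2 : F -> F -> Prop, maximal_congruence S2 /\ congruence_le S1 S2)
  /\
  (forall S : F -> F -> Prop, maximal_congruence S ->
     closed [set XY : fnorm_space N * fnorm_space N | S XY.1 XY.2]).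
Proof.
have E0 := order_unit_ge0 F_neq0 E_unit.
split=> [S1|S [SC Snt Smax]]; first exact: maximal_congruence_exists.
apply: congruence_closure_closed => //.
have [//|tr] :=
  Smax _ (congruence_closureP N SC) (@congruence_le_closure _ _ _ N S).
by have := congruence_closure_nontrivial E_unit E0 SC Snt tr.
Qed.
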